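(* Let $k\ge 3$ and let $H$ be a $k$-Tur\'an-good graph. Let $H'$ be any graph constructed from $H$ as follows: choose a (possibly empty) set $X\subseteq V(H)$ inducing a complete subgraph of $H$, add to $H$ a vertex-disjoint copy of $K_{k-1}$, and join the vertices of $X$ to the vertices of this $K_{k-1}$ by an arbitrary set of edges. Then $H'$ is $k$-Tur\'an-good.
   Context: For graphs $H,G$, $\mathcal{N}(H,G)$ denotes the number of (not necessarily induced) subgraphs of $G$ isomorphic to $H$. For graphs $H,F$, $\mathrm{ex}(n,H,F)$ is the maximum of $\mathcal{N}(H,G)$ over all $n$-vertex graphs $G$ not containing $F$ as a subgraph. The Tur\'an graph $T_{r}(n)$ is the complete $r$-partite graph on $n$ vertices whose classes each have size $\lfloor n/r\rfloor$ or $\lceil n/r\rceil$. For a $k$-chromatic graph $F$ and a graph $H$ not containing $F$ as a subgraph, $H$ is called $F$-Tur\'an-good if $\mathrm{ex}(n,H,F)=\mathcal{N}(H,T_{k-1}(n))$ for every sufficiently large $n$. A graph is $k$-Tur\'an-good if it is $K_k$-Tur\'an-good.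
   Formalization: Since H' may contain K_k (e.g. a vertex of X joined to all of K_{k-1}), ''H' is k-Turán-good'' is taken to mean only ex(n,H',K_k) = N(H',T_{k-1}(n)) for all large n, without asserting that H' is K_k-free; if it is not, both sides are 0. *)

(* Defs.v *)
From HB Require Import structures.
From mathcomp Require Import all_boot.
Set Implicit Arguments. Unset Strict Implicit. Unset Printing Implicit Defensive.

(* A finite simple graph on the vertex type [V]: a set of 2-element subsets. *)
Record graph (V : finType) := Graph {
  edges : {set {set V}};
  edges_card2 : [forall e in edges, #|e| == 2]
}.

(* Makes [graph V] a finType, so that extremal numbers are plain maxima. *)
HB.instance Definition _ (V : finType) := [isSub for @edges V].
HB.instance Definition _ (V : finType) := [Finite of graph V by <:].

Definition adj (V : finType) (G : graph V) : rel V :=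
  fun x y => [set x; y] \in edges G.

Definition rel_edges (V : finType) (r : rel V) : {set {set V}} :=
  [set [set p.1; p.2] | p : V * V & (p.1 != p.2) && r p.1 p.2].

Lemma rel_edges_card2 (V : finType) (r : rel V) :
  [forall e in rel_edges r, #|e| == 2].
Proof.
apply/forall_inP => e /imsetP[p]; rewrite inE => /andP[ne _] ->.
by rewrite cards2 ne.
Qed.

Definition graph_of_rel (V : finType) (r : rel V) : graph V :=
  Graph (rel_edges_card2 r).

Lemma adj_sym (V : finType) (G : graph V) : symmetric (adj G).
Proof. by move=> x y; rewrite /adj setUC. Qed.

Lemma adj_irrefl (V : finType) (G : graph V) : irreflexive (adj G).
Proof.
move=> x; apply/negP => xx.
by have /forall_inP/(_ _ xx) := edges_card2 G; rewrite cards2 eqxx.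
Qed.

Lemma adj_graph_of_rel (V : finType) (r : rel V) : symmetric r ->
  forall x y, adj (graph_of_rel r) x y = (x != y) && r x y.
Proof.
move=> rs x y; apply/idP/idP => [/imsetP[[a b]] | h]; last first.
  by apply/imsetP; exists (x, y); rewrite ?inE.
rewrite inE /= => /andP[ne rab] E.
have xy : x != y.
  by move: (cards2 x y); rewrite E cards2 ne; case: (x != y).
rewrite xy /=.
have := set21 x y; have := set22 x y; rewrite E => /set2P[] yE /set2P[] xE.
- by rewrite xE yE eqxx in xy.
- by rewrite xE yE rs.
- by rewrite xE yE.
- by rewrite xE yE eqxx in xy.
Qed.

Definition complete (n : nat) : graph 'I_n := graph_of_rel (fun _ _ => true).

(* The residue classes mod [r] in {0, .., n-1} have size floor(n/r) or
   ceil(n/r). Meaningful for [r > 0] only. *)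
Definition turan (r n : nat) : graph 'I_n :=
  graph_of_rel (fun i j : 'I_n => i %% r != j %% r).

(* [G] has a, not necessarily induced, subgraph isomorphic to [F]. *)
Definition contains (U V : finType) (F : graph U) (G : graph V) : bool :=
  [exists f : {ffun U -> V},
     injectiveb f && [forall x, forall y, adj F x y ==> adj G (f x) (f y)]].

(* A subgraph is a pair of a vertex set and an edge set. *)
Definition is_subgraph (V : finType) (G : graph V)
    (S : {set V} * {set {set V}}) : bool :=
  (S.2 \subset edges G) && [forall e in S.2, e \subset S.1].

Definition isomorphic_to (U V : finType) (H : graph U)
    (S : {set V} * {set {set V}}) : bool :=
  [exists f : {ffun U -> V},
     [&& injectiveb f, f @: [set: U] == S.1 &
         [forall x, forall y, adj H x y == ([set f x; f y] \in S.2)]]].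

Definition num_copies (U V : finType) (H : graph U) (G : graph V) : nat :=
  #|[set S : {set V} * {set {set V}} | is_subgraph G S && isomorphic_to H S]|.

Definition ex (n : nat) (U W : finType) (H : graph U) (F : graph W) : nat :=
  \max_(G : graph 'I_n | ~~ contains F G) num_copies H G.

Definition colorable (V : finType) (G : graph V) (c : nat) : bool :=
  [exists f : {ffun V -> 'I_c}, forall x, forall y, adj G x y ==> (f x != f y)].

Lemma colorable_card (V : finType) (G : graph V) : exists c, colorable G c.
Proof.
exists #|V|; apply/existsP; exists [ffun x => enum_rank x].
apply/forallP => x; apply/forallP => y; apply/implyP => xy.
rewrite !ffunE (inj_eq enum_rank_inj); apply: contraTneq xy => ->.
by rewrite adj_irrefl.
Qed.

Definition chromatic_number (V : finType) (G : graph V) : nat :=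
  ex_minn (colorable_card G).

(* This notion is meant for graphs [H] not containing [F]. That proviso is not
   part of the predicate; if [H] contains [F], both counts are 0 as soon as [F]
   has an edge. *)
Definition turan_good (W U : finType) (F : graph W) (H : graph U) : Prop :=
  exists n0, forall n, n0 <= n ->
    ex n H F = num_copies H (turan (chromatic_number F).-1 n).

Definition k_turan_good (k : nat) (U : finType) (H : graph U) : Prop :=
  turan_good (complete k) H.

Definition is_clique (V : finType) (G : graph V) (X : {set V}) : Prop :=
  {in X &, forall x y, x != y -> adj G x y}.

(* [H'] is the disjoint union of [H] and K_m together with an arbitrary set of
   edges between [X] and K_m. *)
Definition clique_attachment (V : finType) (m : nat) (H : graph V)
    (X : {set V}) (H' : graph (V + 'I_m)%type) : Prop :=
  [/\ forall x y : V, adj H' (inl x) (inl y) = adj H x y,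
      forall i j : 'I_m, adj H' (inr i) (inr j) = adj (complete m) i j
    & forall (x : V) (i : 'I_m), adj H' (inl x) (inr i) -> x \in X].

(* Main.v *)
Require Import Defs.
From mathcomp Require Import all_boot all_fingroup zify.

(** Put r = k - 1 and count embeddings instead of copies; the two differ by the
    factor |Aut H|, which does not depend on the host graph. An embedding of H'
    is an embedding g of K_r together with an embedding f of H avoiding the
    image Q of g, such that f and g realise the edges between X and K_r. In a
    K_k-free host G each of the three factors is at most its value in T_r(n):
    - the number of copies of K_r, by a theorem of Zykov;
    - the number of embeddings of H into G - Q, as H is k-Turan-good and
      T_r(n) - Q is isomorphic to T_r(n - r);
    - the number of orderings of Q compatible with a given f: K_k-freeness is
      exactly Hall's condition for a matching of non-adjacent pairs between
      f(X) and Q that covers f(X), and in T_r(n) the pairs of this matching are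
      the only non-adjacent ones. *)

Set Implicit Arguments. Unset Strict Implicit. Unset Printing Implicit Defensive.

(** * Hall's marriage theorem, and permutations with prescribed values *)

Section Hall.
Variables (I T : finType) (t0 : T).

(** Induction on [#|S|]. If a nonempty proper subset [J] is tight, match [J] inside its
    neighbourhood [U] and the rest of [S] outside [U]. Otherwise any value may be spent on one
    index. [t0] is the default value outside [S]. *)
Lemma hall_matching (A : I -> {set T}) (S : {set I}) :
    (forall J : {set I}, J \subset S -> #|J| <= #|\bigcup_(j in J) A j|) ->
  exists2 f : I -> T, {in S &, injective f} & {in S, forall i, f i \in A i}.
Proof.
have [n] := ubnP #|S|; elim: n A S => // n IHn A S ltSn hallS.
have [->|[i0 i0S]] := set_0Vmem S.
  by exists (fun=> t0) => [x y|x]; rewrite inE.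
case: (boolP [exists J : {set I},
   [&& J \proper S, J != set0 & #|\bigcup_(j in J) A j| <= #|J|]]).
  case/existsP=> J /and3P[JS Jn0 leUJ]; set U := \bigcup_(j in J) A j in leUJ.
  have [f1 inj1 f1A] : exists2 f : I -> T, {in J &, injective f}
      & {in J, forall i, f i \in A i}.
    apply: IHn => [|K KJ]; first by have := proper_card JS; lia.
    by apply: hallS; apply: subset_trans KJ (proper_sub JS).
  have [f2 inj2 f2A] : exists2 f : I -> T, {in S :\: J &, injective f}
      & {in S :\: J, forall i, f i \in A i :\: U}.
    apply: IHn => [|K].
      have := cardsD S J; rewrite (setIidPr (proper_sub JS)).
      have := subset_leq_card (proper_sub JS).
      by move: Jn0; rewrite -card_gt0; lia.
    rewrite subsetD => /andP[KS dKJ].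
    (* Hall's condition for [K :|: J], less the at most [#|J|] elements of [U], leaves at least
       [#|K|] values for [K]. *)
    have := hallS (K :|: J); rewrite subUset KS (proper_sub JS) => /(_ isT).
    rewrite cardsU (disjoint_setI0 dKJ) cards0 subn0 => le1.
    have : #|\bigcup_(j in K :|: J) A j| <= #|\bigcup_(j in K) (A j :\: U)| +
      #|U|.
      apply: leq_trans (_ : #|(\bigcup_(j in K) (A j :\: U)) :|: U| <= _).
        apply: subset_leq_card; apply/bigcupsP => j; rewrite inE.
        case: (boolP (j \in J)) => [jJ _|_]; last rewrite orbF => jK.
          by apply: subset_trans (subsetUr _ _); apply: bigcup_sup.
        apply/subsetP => t tA; rewrite inE orbC.
        case: (boolP (t \in U)) => //= tU.
        by apply/bigcupP; exists j => //; rewrite inE tU.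
      by rewrite cardsU; lia.
    by lia.
  exists (fun i => if i \in J then f1 i else f2 i) => [x y xS yS|x xS].
    case: ifP => xJ; case: ifP => yJ.
    - exact: inj1.
    - move=> E; have := f2A y; rewrite !inE yJ yS => /(_ isT).
      by rewrite -E; case/andP => /bigcupP[]; exists x => //; apply: f1A.
    - move=> E; have := f2A x; rewrite !inE xJ xS => /(_ isT).
      by rewrite E; case/andP => /bigcupP[]; exists y => //; apply: f1A.
    - by apply: inj2; rewrite inE ?xJ ?yJ.
  case: ifP => xJ; first exact: f1A.
  by have := f2A x; rewrite !inE xJ xS => /(_ isT) /andP[].
move/existsPn => noJ.
have [t tA] : exists t, t \in A i0.
  apply/set0Pn; rewrite -card_gt0.
  by have := hallS [set i0]; rewrite sub1set i0S big_set1 cards1 => /(_ isT).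
have [f inj_f fA] : exists2 f : I -> T, {in S :\ i0 &, injective f}
    & {in S :\ i0, forall i, f i \in A i :\ t}.
  apply: IHn => [|J]; first by rewrite (cardsD1 i0) i0S in ltSn.
  rewrite subsetD1 => /andP[JS iJ].
  have [->|Jn0] := eqVneq J set0; first by rewrite cards0.
  have pJ : J \proper S.
    by apply/properP; split=> //; exists i0.
  (* As [J] is not tight, the union over it has an element to spare and can lose [t]. *)
  have := noJ J; rewrite pJ Jn0 /= -ltnNge => lt1.
  have : \bigcup_(j in J) A j \subset t |: \bigcup_(j in J) (A j :\ t).
    apply/bigcupsP => j jJ; apply/subsetP => u uA; rewrite !inE.
    case: eqVneq => //= ut; apply/bigcupP; exists j => //.
    by rewrite !inE ut.
  by move/subset_leq_card; rewrite cardsU1; lia.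
exists (fun i => if i == i0 then t else f i) => [x y xS yS|x xS].
  case: eqVneq => [->|xi]; case: eqVneq => [->|yi] // E.
  - by have := fA y; rewrite !inE yi yS -E eqxx => /(_ isT).
  - by have := fA x; rewrite !inE xi xS E eqxx => /(_ isT).
  - by apply: inj_f; rewrite // !inE ?xi ?yi.
case: eqVneq => [->//|xi].
by have := fA x; rewrite !inE xi xS => /(_ isT) /andP[].
Qed.

End Hall.

(** A permutation carrying the tail of [s1] to the tail of [s2] is corrected by one transposition,
    which sends the image of the head to [b] and fixes the tail of [s2]. *)
Lemma perm_map_eq (T : finType) (s1 s2 : seq T) :
    uniq s1 -> uniq s2 -> size s1 = size s2 ->
  exists p : {perm T}, map p s1 = s2.
Proof.
elim: s1 s2 => [|a s1 IH] [|b s2] //=; first by exists 1%g.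
case/andP=> a1 u1 /andP[b2 u2] [sz]; have [p ps] := IH s2 u1 u2 sz.
exists (p * tperm (p a) b)%g; rewrite permM tpermL; congr cons.
rewrite -[in RHS]ps; apply/eq_in_map => x x1; rewrite permM tpermD //.
  by rewrite (inj_eq perm_inj); apply: contraNneq a1 => ->.
by apply: contraNneq b2 => ->; rewrite -ps map_f.
Qed.

(** * Embeddings versus copies *)

Section Embeddings.
Variables (U V : finType).

Definition embeddings (H : graph U) (G : graph V) : {set {ffun U -> V}} :=
  [set f : {ffun U -> V} | injectiveb f &&
     [forall x, forall y, adj H x y ==> adj G (f x) (f y)]].

Lemma embeddingsP (H : graph U) (G : graph V) (f : {ffun U -> V}) :
  reflect (injective f /\ forall x y, adj H x y -> adj G (f x) (f y))
          (f \in embeddings H G).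
Proof.
rewrite inE; apply: (iffP andP) => -[/injectiveP fI fA]; split => //.
- by move=> x y; apply/implyP; move/forallP/(_ x)/forallP/(_ y): fA.
- by apply/forallP => x; apply/forallP => y; apply/implyP/fA.
Qed.

End Embeddings.

Section Copies.
Variables (U V : finType) (H : graph U) (G : graph V).

Definition automorphisms : {set {ffun U -> U}} :=
  [set s : {ffun U -> U} | injectiveb s &&
     [forall x, forall y, adj H x y == adj H (s x) (s y)]].

Lemma automorphisms_gt0 : 0 < #|automorphisms|.
Proof.
apply/card_gt0P; exists [ffun x => x]; rewrite inE; apply/andP; split.
  by apply/injectiveP => x y; rewrite !ffunE.
by apply/forallP => x; apply/forallP => y; rewrite !ffunE.
Qed.

Definition copy_of (f : {ffun U -> V}) : {set V} * {set {set V}} :=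
  (f @: setT, [set [set f p.1; f p.2] | p : U * U & adj H p.1 p.2]).

Lemma edge_set2 (W : finType) (K : graph W) e : e \in edges K ->
  exists x y, e = [set x; y].
Proof.
move=> eK; have /forall_inP/(_ _ eK) := edges_card2 K.
by case/cards2P => x [y [_ ->]]; exists x, y.
Qed.

Lemma set2_eq (f : U -> V) : injective f -> forall x y a b,
  [set f x; f y] = [set f a; f b] -> [set x; y] = [set a; b].
Proof.
move=> fI x y a b; rewrite -!imset_set1 -!imsetU => E.
exact: (imset_inj fI).
Qed.

(** Describes the fibre of [copy_of] over [S] in the terms of [isomorphic_to]. Edges of [S] have
    their ends in [S.1], the image of [f], so each comes from a pair in [U]. *)
Lemma copy_ofP (S : {set V} * {set {set V}}) (f : {ffun U -> V}) :
    is_subgraph G S ->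
  ((f \in embeddings H G) && (copy_of f == S)) =
  [&& injectiveb f, f @: [set: U] == S.1 &
         [forall x, forall y, adj H x y == ([set f x; f y] \in S.2)]].
Proof.
case: S => S1 S2 /andP[/= S2G /forall_inP S2S]; apply/andP/and3P.
  case=> /embeddingsP[fI fA] /eqP[ES1 ES2]; split; first exact/injectiveP.
    exact/eqP.
  apply/forallP => x; apply/forallP => y; apply/eqP; rewrite -ES2.
  apply/idP/imsetP => [xy|[[a b]]]; first by exists (x, y); rewrite ?inE.
  by rewrite inE /= => ab /(set2_eq fI) E; rewrite /adj E.
case=> /injectiveP fI /eqP ES1 /forallP fA.
have {}fA x y : adj H x y = ([set f x; f y] \in S2).
  by apply/eqP; move/forallP/(_ y): (fA x).
split.
  by apply/embeddingsP; split => // x y; rewrite fA; apply/subsetP.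
apply/eqP; congr pair => //; apply/setP => e; apply/imsetP/idP.
  by case=> [[x y]]; rewrite inE /= fA => ? ->.
move=> eS; have [x [y E]] := edge_set2 (subsetP S2G _ eS).
have := S2S e eS; rewrite E subUset !sub1set -ES1.
case/andP=> /imsetP[a _ xa] /imsetP[b _ yb].
by exists (a, b); rewrite ?inE /= ?fA -xa -yb // -E.
Qed.

(** Sort the embeddings by the copy they trace out. Those onto one copy arise from a single one,
    [f0], by composing with the automorphisms of [H]. *)
Lemma card_embeddings :
  #|embeddings H G| = num_copies H G * #|automorphisms|.
Proof.
rewrite -sum1_card.
rewrite (partition_big copy_of
  (mem [set S | is_subgraph G S && isomorphic_to H S])) /=; last first.
  move=> f fE; rewrite inE.
  have sub : is_subgraph G (copy_of f).
    case/embeddingsP: fE => fI fA; apply/andP; split => /=.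
      by apply/subsetP => e /imsetP[[x y]]; rewrite inE /= => /fA ? ->.
    apply/forall_inP => e /imsetP[[x y]] _ ->.
    by rewrite subUset !sub1set !imset_f.
  rewrite sub /=; apply/existsP; exists f.
  by rewrite -copy_ofP // fE eqxx.
rewrite /num_copies -sum_nat_const; apply: eq_bigr => S; rewrite inE.
case/andP=> sub /existsP[f0 Hf0]; rewrite sum1_card.
pose comp (s : {ffun U -> U}) := [ffun x => f0 (s x)].
case/and3P: Hf0 => /injectiveP f0I /eqP f0S /forallP f0A.
have {}f0A x y : adj H x y = ([set f0 x; f0 y] \in S.2).
  by apply/eqP; move/forallP/(_ y): (f0A x).
rewrite -(card_imset (f := comp)); last first.
  by move=> s t /ffunP E; apply/ffunP => x; move: (E x); rewrite !ffunE => /f0I.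
apply: eq_card => f; rewrite -topredE /= copy_ofP //; apply/and3P/imsetP.
  case=> /injectiveP fI /eqP fS /forallP fA.
  have im x : exists y, f0 y == f x.
    have : f x \in f0 @: setT by rewrite f0S -fS imset_f.
    by case/imsetP=> y _ ->; exists y.
  have f0s x : f0 (xchoose (im x)) = f x := eqP (xchooseP (im x)).
  exists [ffun x => xchoose (im x)]; last by apply/ffunP => x; rewrite !ffunE.
  rewrite inE; apply/andP; split.
    by apply/injectiveP => x y; rewrite !ffunE => /(congr1 f0);
      rewrite !f0s => /fI.
  apply/forallP => x; apply/forallP => y; rewrite !ffunE (f0A (xchoose _)) !f0s.
  by move/forallP/(_ y): (fA x).
case=> s; rewrite inE => /andP[/injectiveP sI /forallP sA] ->; split.
- by apply/injectiveP => x y; rewrite !ffunE => /f0I /sI.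
- rewrite -f0S eqEcard; apply/andP; split.
    by apply/subsetP => _ /imsetP[x _ ->]; rewrite ffunE imset_f.
  rewrite !card_imset //.
  by move=> x y; rewrite !ffunE => /f0I /sI.
- apply/forallP => x; apply/forallP => y; rewrite !ffunE -f0A.
  by move/forallP/(_ y): (sA x).
Qed.

End Copies.

Lemma leq_num_copies (U V W : finType) (H : graph U) (G : graph V) (K : graph
  W) :
  (num_copies H G <= num_copies H K) = (#|embeddings H G| <= #|embeddings H K|).
Proof. by rewrite !card_embeddings leq_pmul2r // automorphisms_gt0. Qed.

(** * Counting cliques relative to a fixed clique *)

Section Cliques.
Variables (V : finType) (G : graph V).
Implicit Types (A B C Q S : {set V}).

Definition cliqueb A : bool :=
  [forall x in A, forall y in A, (x != y) ==> adj G x y].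

Lemma cliqueP A : reflect (is_clique G A) (cliqueb A).
Proof.
apply: (iffP forall_inP) => cA x.
  by move=> y /cA/forall_inP Ax /Ax/implyP.
by move=> xA; apply/forall_inP => y yA; apply/implyP/cA.
Qed.

Definition num_cliques S t :=
  #|[set A : {set V} | [&& A \subset S, cliqueb A & #|A| == t]]|.

Definition common_nbrs C Q := [set v in Q | [forall c in C, adj G c v]].

Lemma cliqueU A B : [disjoint A & B] ->
  cliqueb (A :|: B) =
  [&& cliqueb A, cliqueb B & B \subset common_nbrs A B].
Proof.
move=> dAB; apply/cliqueP/and3P => [cAB|[/cliqueP cA /cliqueP cB /subsetP BN]].
  split.
  - by apply/cliqueP => x y xA yA; apply: cAB; rewrite inE ?xA ?yA.
  - by apply/cliqueP => x y xB yB; apply: cAB; rewrite inE ?xB ?yB orbT.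
  - apply/subsetP => b bB; rewrite inE bB; apply/forall_inP => a aA.
    apply: cAB; rewrite ?inE ?aA ?bB ?orbT //.
    by apply: contraTneq aA => ->; apply: contraTN bB => /(disjointFr dAB) ->.
move=> x y /setUP[] xA /setUP[] yA; [exact: cA| | |exact: cB].
- by have := BN y yA; rewrite inE yA => /forall_inP/(_ x xA).
- by have := BN x xA; rewrite inE xA adj_sym => /forall_inP/(_ y yA).
Qed.

Lemma sub_clique A B : A \subset B -> cliqueb B -> cliqueb A.
Proof.
move=> /subsetP AB /cliqueP cB; apply/cliqueP => x y /AB xB /AB yB; exact: cB.
Qed.

(** Sort the cliques by their part [C] outside [Q]. As [Q] is a clique, the part inside [Q] can be
    any set of the right size among the common neighbours of [C]. *)
Lemma num_cliques_split S Q t : Q \subset S -> cliqueb Q ->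
  num_cliques S t =
  \sum_(C in powerset (S :\: Q) | cliqueb C && (#|C| <= t))
     'C(#|common_nbrs C Q|, t - #|C|).
Proof.
move=> QS cQ; rewrite /num_cliques -sum1_card.
rewrite (partition_big (fun A => A :\: Q)
  (fun C => (C \in powerset (S :\: Q)) && (cliqueb C && (#|C| <= t)))) /=;
    last first.
  move=> A; rewrite !inE => /and3P[AS cA /eqP <-].
  by rewrite setSD //= (sub_clique (subsetDl _ _) cA) subset_leq_card ?subsetDl.
apply: eq_bigr => C; rewrite inE => /and3P[CSQ cC leC].
have dCQ : [disjoint C & Q] by case/subsetDP: CSQ.
rewrite -cards_draws sum1_card; symmetry;
  rewrite -(card_in_imset (f := fun B => C :|: B)); last first.
  have E B : B \in [set A : {set V} | A \subset common_nbrs C Q & #|A| == t -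
    #|C|] ->
      (C :|: B) :&: Q = B.
    rewrite inE => /andP[BN _].
    have BQ : B \subset Q by apply: subset_trans BN _; apply/subsetP => v;
      rewrite inE => /andP[].
    by rewrite setIUl (disjoint_setI0 dCQ) set0U; apply/setIidPl.
  by move=> B B' BI BI' /= EE; rewrite -(E B BI) EE E.
symmetry; apply: eq_card => A; rewrite -topredE /= inE; apply/andP/imsetP.
  case=> /and3P[AS cA /eqP cardA] /eqP EC.
  have EA : A = C :|: (A :&: Q) by rewrite -EC setUC setID.
  have dC : [disjoint C & A :&: Q].
    by apply: disjointWr dCQ; apply: subsetIr.
  exists (A :&: Q) => //; rewrite inE; apply/andP; split.
    move: cA; rewrite {1}EA cliqueU // => /and3P[_ _ /subsetP sub].
    apply/subsetP => v vAQ; have := sub v vAQ; rewrite !inE.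
    by case/andP => /andP[_ ->].
  have := cardsU C (A :&: Q); rewrite -EA cardA (disjoint_setI0 dC) cards0.
  by lia.
case=> B; rewrite inE => /andP[/subsetP BN /eqP cardB] ->.
have BQ : B \subset Q by apply/subsetP => v /BN; rewrite inE => /andP[].
have dC : [disjoint C & B] by apply: disjointWr dCQ.
split; last first.
  apply/eqP; rewrite setDUl (eqP (_ : B :\: Q == set0)) ?setD_eq0 // setU0.
  by apply/setDidPl.
apply/and3P; split.
- rewrite subUset (subset_trans BQ QS) andbT.
  by apply: subset_trans CSQ (subsetDl _ _).
- rewrite cliqueU // cC (sub_clique BQ cQ); apply/subsetP => v vB.
  by have := BN v vB; rewrite !inE vB => /andP[].
- by rewrite cardsU (disjoint_setI0 dC) cards0 cardB; lia.
Qed.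

(** Bounds that depend only on [#|C|] thereby become sums of clique counts of the smaller set, ready
    for induction. *)
Lemma sum_over_cliques S t (F : nat -> nat) :
  \sum_(C in powerset S | cliqueb C && (#|C| <= t)) F #|C| =
  \sum_(s < t.+1) num_cliques S s * F s.
Proof.
(* [inord] is exact here because [#|C| <= t]. *)
rewrite (partition_big (fun C => inord #|C| : 'I_t.+1) predT) //=.
apply: eq_bigr => s _; rewrite -sum_nat_const big_mkcond [RHS]big_mkcond /=.
apply: eq_bigr => C _; rewrite !inE -!andbA.
case: (C \subset S) => //=; case: (cliqueb C) => //=.
have -> : (#|C| <= t) && (inord #|C| == s) = (#|C| == s).
  apply/andP/eqP => [[le /eqP <-]|->]; first by rewrite inordK.
  by rewrite -ltnS ltn_ord inord_val.
by case: eqP => [->|].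
Qed.

(** [C] and its common neighbours in [Q] together form a clique, so by maximality there are at most
    [#|Q| - #|C|] such neighbours. *)
Lemma num_cliques_leq_max_clique S Q t : Q \subset S -> cliqueb Q ->
    (forall A, A \subset S -> cliqueb A -> #|A| <= #|Q|) ->
  num_cliques S t <=
  \sum_(s < t.+1) num_cliques (S :\: Q) s * 'C(#|Q| - s, t - s).
Proof.
move=> QS cQ maxQ; rewrite (num_cliques_split t QS cQ).
rewrite -(sum_over_cliques _ t (fun s => 'C(#|Q| - s, t - s))).
apply: leq_sum => C; rewrite inE => /and3P[CSQ cC leC].
apply: leq_bin2l; rewrite leq_subRL; last first.
  by apply: maxQ => //; apply: subset_trans CSQ (subsetDl _ _).
have NQ : common_nbrs C Q \subset Q by apply/subsetP => v;
  rewrite inE => /andP[].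
have dC : [disjoint C & common_nbrs C Q].
  by apply: disjointWr NQ _; case/subsetDP: CSQ.
have := cardsU C (common_nbrs C Q).
rewrite (disjoint_setI0 dC) cards0 subn0 => <-; apply: maxQ.
  rewrite subUset (subset_trans NQ QS) andbT.
  by apply: subset_trans CSQ (subsetDl _ _).
rewrite cliqueU // cC (sub_clique NQ cQ) /=.
by apply/subsetP => v; rewrite !inE => /andP[-> ->].
Qed.

(** Each vertex of [C] rules out at most one vertex of [Q], so at least [#|Q| - #|C|] common
    neighbours remain. This is the reverse bound, for use in the Turan graph. *)
Lemma num_cliques_geq_one_nonnbr S Q t : Q \subset S -> cliqueb Q ->
    (forall v, v \in S -> #|[set q in Q | ~~ adj G v q]| <= 1) ->
  \sum_(s < t.+1) num_cliques (S :\: Q) s * 'C(#|Q| - s, t - s) <=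
  num_cliques S t.
Proof.
move=> QS cQ missQ; rewrite (num_cliques_split t QS cQ).
rewrite -(sum_over_cliques _ t (fun s => 'C(#|Q| - s, t - s))).
apply: leq_sum => C; rewrite inE => /and3P[CSQ cC leC].
apply: leq_bin2l; rewrite leq_subLR.
have : Q \subset common_nbrs C Q :|: \bigcup_(c in C) [set q in Q | ~~ adj G c
  q].
  apply/subsetP => q qQ; rewrite !inE qQ /=.
  case: (boolP [forall c in C, adj G c q]) => //= /forall_inPn[c cC' ncq].
  by apply/bigcupP; exists c; rewrite // inE qQ.
move/subset_leq_card/leq_trans; apply; rewrite cardsU.
apply: leq_trans (leq_subr _ _) _; rewrite addnC leq_add2r.
rewrite -[X in _ <= X]sum1_card; elim/big_rec2: _ => [|c n A cC' IH];
  first by rewrite cards0.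
rewrite cardsU; apply: leq_trans (leq_subr _ _) _; apply: leq_add IH.
by apply: missQ; have := subsetP CSQ c cC'; rewrite inE => /andP[].
Qed.

Lemma card_embeddings_complete t :
  #|embeddings (complete t) G| = num_cliques setT t * t`!.
Proof.
rewrite -sum1_card.
rewrite (partition_big (fun f : {ffun 'I_t -> V} => f @: setT)
  (fun A => A \in [set A : {set V} | [&& A \subset setT, cliqueb A & #|A| ==
    t]])) /=; last first.
  move=> f /embeddingsP[fI fA];
    rewrite inE subsetT card_imset // cardsT card_ord eqxx andbT.
  apply/cliqueP => _ _ /imsetP[x _ ->] /imsetP[y _ ->] ne; apply: fA.
  by rewrite adj_graph_of_rel // andbT; apply: contraNneq ne => ->.
rewrite /num_cliques -sum_nat_const; apply: eq_bigr => A.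
rewrite inE subsetT /= => /andP[/cliqueP cA /eqP cardA].
have -> : t`! = #|A| ^_ #|'I_t| by rewrite cardA card_ord ffactnn.
rewrite sum1_card -card_inj_ffuns_on.
apply: eq_card => f; rewrite -topredE /= [RHS]inE; apply/andP/andP.
  case=> /embeddingsP[fI _] /eqP <-; split; last exact/injectiveP.
  by apply/ffun_onP => i; rewrite imset_f.
case=> /ffun_onP fA /injectiveP fI; split.
  apply/embeddingsP; split=> // x y; rewrite adj_graph_of_rel // andbT => ne.
  by apply: cA => //; rewrite (inj_eq fI).
rewrite eqEcard; apply/andP; split.
  by apply/subsetP => _ /imsetP[x _ ->]; apply: fA.
by rewrite card_imset // cardsT card_ord cardA.
Qed.

Lemma free_clique_card k A :
  ~~ contains (complete k) G -> cliqueb A -> #|A| < k.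
Proof.
move=> free /cliqueP cA; rewrite ltnNge; apply: contra free => leA.
apply/existsP; exists [ffun i => enum_val (widen_ord leA i)].
have fI : injective (fun i => enum_val (widen_ord leA i)).
  by move=> i j /enum_val_inj/(congr1 val) /= ?; apply: val_inj.
apply/andP; split; first by apply/injectiveP => i j; rewrite !ffunE => /fI.
apply/forallP => i; apply/forallP => j;
  rewrite adj_graph_of_rel // andbT !ffunE.
by apply/implyP => ne; apply: cA; rewrite ?enum_valP // (inj_eq fI).
Qed.

End Cliques.

(** * Turan graphs and Zykov's theorem *)

Lemma adj_turan r n (i j : 'I_n) : adj (turan r n) i j = (i %% r != j %% r).
Proof.
rewrite adj_graph_of_rel => [|x y]; last by rewrite eq_sym.
by case: eqVneq => [->|//]; rewrite eqxx.
Qed.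

(* Induction deleting a maximum clique of [S], against the last vertices of the
   Turan graph, which form a clique of the same size. *)
Lemma leq_num_cliques_turan (V : finType) (G : graph V) r n (S : {set V}) t :
    (forall A : {set V}, cliqueb G A -> #|A| <= r) -> #|S| <= n ->
  num_cliques G S t <= num_cliques (turan r n) [set i : 'I_n | i < #|S|] t.
Proof.
move=> maxr; have [m] := ubnP #|S|; elim: m S t => // m IHm S t ltSm leSn.
have [S0|[v vS]] := set_0Vmem S.
  rewrite /num_cliques; apply: leq_trans (_ : (t == 0) <= _).
    case: eqP => [->|t0].
      rewrite /= -(cards1 (set0 : {set V})); apply/subset_leq_card/subsetP => A.
      by rewrite !inE S0 subset0 => /and3P[].
    rewrite leqn0 cards_eq0; apply/eqP/setP => A; rewrite !inE S0 subset0.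
    apply/negP => /and3P[/eqP -> _]; rewrite cards0 => /eqP; lia.
  case: eqP => // ->; apply/card_gt0P; exists set0;
    rewrite inE sub0set cards0 eqxx andbT.
  by apply/cliqueP => x y; rewrite inE.
have [Q /andP[QS cQ] maxQ] : exists2 Q : {set V}, (Q \subset S) && cliqueb G Q &
    forall A : {set V}, (A \subset S) && cliqueb G A -> #|A| <= #|Q|.
  have P0 : ([set v] \subset S) && cliqueb G [set v].
    rewrite sub1set vS; apply/cliqueP => x y /set1P -> /set1P ->.
    by rewrite eqxx.
  have := @arg_maxnP _ [set v] (fun A => (A \subset S) && cliqueb G A)
    (fun A : {set V} => #|A|) P0.
  by case=> Q PQ maxQ; exists Q.
have maxQ' (A : {set V}) : A \subset S -> cliqueb G A -> #|A| <= #|Q|.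
  by move=> AS cA; apply: maxQ; rewrite AS.
have Q_gt0 : 0 < #|Q|.
  rewrite -(cards1 v); apply: maxQ'; first by rewrite sub1set.
  by apply/cliqueP => x y /set1P -> /set1P ->; rewrite eqxx.
have leQr := maxr Q cQ; have leQS := subset_leq_card QS.
have cardSQ : #|S :\: Q| = #|S| - #|Q| by rewrite cardsD (setIidPr QS).
pose Q' := [set i : 'I_n | (#|S| - #|Q| <= i) && (i < #|S|)].
have ES : [set i : 'I_n | i < #|S|] :\: Q' = [set i : 'I_n | i < #|S :\: Q|].
  by apply/setP => i; rewrite !inE cardSQ; lia.
have cardS' (p : nat) : p <= n -> #|[set i : 'I_n | i < p]| = p.
  move=> lepn; have wI : injective (widen_ord lepn) by move=> i j /(congr1 val)
    /= E; apply: val_inj.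
  rewrite -[RHS]card_ord -(card_imset _ wI).
  apply: eq_card => i; rewrite inE; apply/idP/imsetP => [lti|[j _ ->]] //=.
  by exists (Ordinal lti) => //; apply: val_inj.
have Q'S : Q' \subset [set i : 'I_n | i < #|S|].
  by apply/subsetP => i; rewrite !inE => /andP[].
have cardQ' : #|Q'| = #|Q|.
  have := cardsD [set i : 'I_n | i < #|S|] Q'.
  rewrite (setIidPr Q'S) ES !cardS' ?cardSQ //; last by lia.
  by have := subset_leq_card Q'S; rewrite cardS' //; lia.
(* [Q'] is an interval of at most [r] integers, so its residues are distinct. Hence it is a clique,
   and a vertex misses at most the one element sharing its residue. *)
have Q'mod i j : i \in Q' -> j \in Q' -> i %% r = j %% r -> i = j.
  rewrite !inE => /andP[li ui] /andP[lj uj] E; apply: val_inj => /=.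
  wlog leij : i j li ui lj uj E / i <= j => [W|].
    by case: (leqP i j) => ?; [|symmetry]; apply: W => //; apply: ltnW.
  have : r %| j - i by rewrite -eqn_mod_dvd // E.
  have [d0 _|d0 /(dvdn_leq d0)] := posnP (j - i); lia.
apply: leq_trans (num_cliques_leq_max_clique t QS cQ maxQ') _.
apply: leq_trans (num_cliques_geq_one_nonnbr t Q'S _ _); last first.
- move=> i _; rewrite leqNgt; apply/negP => /card_gt1P[a [b [+ + ne]]].
  rewrite !(inE, adj_turan, negbK) => /andP[aQ /eqP Ea] /andP[bQ /eqP Eb].
  by move/eqP: ne; apply; apply: Q'mod; rewrite ?inE // -Ea.
- apply/cliqueP => i j iQ jQ; rewrite adj_turan; apply: contraNneq.
  by move/(Q'mod _ _ iQ jQ) ->.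
rewrite cardQ' ES; apply: leq_sum => s _; rewrite leq_mul2r; apply/orP; right.
by apply: IHm; rewrite cardSQ; lia.
Qed.

Lemma leq_embeddings_complete_turan r n (G : graph 'I_n) t :
    ~~ contains (complete r.+1) G ->
  #|embeddings (complete t) G| <= #|embeddings (complete t) (turan r n)|.
Proof.
move=> free; rewrite !card_embeddings_complete leq_mul2r; apply/orP; right.
have := @leq_num_cliques_turan _ G r n setT t;
  rewrite cardsT card_ord => /(_ _ (leqnn n)).
have -> : [set i : 'I_n | i < n] = setT by apply/setP => i;
  rewrite !inE ltn_ord.
by apply=> A cA; rewrite -ltnS; apply: free_clique_card cA.
Qed.

Lemma chromatic_number_complete k : chromatic_number (complete k) = k.
Proof.
rewrite /chromatic_number; case: ex_minnP => c /existsP[f /forallP fA] minc.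
apply/eqP; rewrite eqn_leq minc /=.
  rewrite -{1}(card_ord k) -(card_ord c); apply: (leq_card f) => x y E.
  move/forallP/(_ y): (fA x); rewrite adj_graph_of_rel // andbT E eqxx implybF.
  by rewrite negbK => /eqP.
apply/existsP; exists [ffun x => x]; apply/forallP => x; apply/forallP => y.
by rewrite !ffunE adj_graph_of_rel // andbT implybb.
Qed.

Lemma turan_free r n : 0 < r -> ~~ contains (complete r.+1) (turan r n).
Proof.
move=> r_gt0; apply/negP => /existsP[f /andP[/injectiveP fI /forallP fA]].
pose h (i : 'I_r.+1) : 'I_r := Ordinal (ltn_pmod (f i) r_gt0).
have hI : injective h.
  move=> x y /(congr1 val) /= E; move/forallP/(_ y): (fA x).
  by rewrite adj_graph_of_rel // andbT adj_turan E eqxx implybF negbK => /eqP.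
by have := leq_card h hI; rewrite !card_ord ltnn.
Qed.

(** * Deleting an [r]-clique from the host *)

Section Deletion.
Variables (U : finType) (H : graph U) (r n : nat).

Definition embeddings_avoiding (V : finType) (G : graph V) (g : {ffun 'I_r ->
  V}) :=
  [set f in embeddings H G | [forall x, forall i, f x != g i]].

(** The vertices outside the image of [g] are relabelled by an ordinal type, since [bound] speaks of
    such graphs. The graph [K] they induce inherits freeness, and every embedding avoiding [g]
    factors through it. *)
Lemma embeddings_avoiding_leq (V : finType) (G : graph V) (g : {ffun 'I_r ->
  V}) N k :
    ~~ contains (complete k) G -> injective g ->
    (forall K : graph 'I_(#|V| - r), ~~ contains (complete k) K ->
       #|embeddings H K| <= N) ->
  #|embeddings_avoiding G g| <= N.
Proof.
move=> free gI bound.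
have cardC : #|~: (g @: setT)| = #|V| - r.
  by rewrite cardsCs setCK card_imset // cardsT card_ord.
pose e (i : 'I_(#|V| - r)) := enum_val (cast_ord (esym cardC) i).
have eI : injective e by move=> i j /enum_val_inj/cast_ord_inj.
pose K := graph_of_rel (fun i j => adj G (e i) (e j)).
have adjK i j : adj K i j = adj G (e i) (e j).
  rewrite adj_graph_of_rel => [|x y]; last by rewrite adj_sym.
  by case: eqVneq => [->|//]; rewrite adj_irrefl.
have freeK : ~~ contains (complete k) K.
  apply: contra free => /existsP[f /andP[/injectiveP fI /forallP fA]].
  apply/existsP; exists [ffun i => e (f i)]; apply/andP; split.
    by apply/injectiveP => x y; rewrite !ffunE => /eI/fI.
  apply/forallP => x; apply/forallP => y; rewrite !ffunE -adjK.
  by move/forallP/(_ y): (fA x).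
apply: leq_trans (bound K freeK).
apply: leq_trans (leq_imset_card (fun f : {ffun _} => [ffun x => e (f x)]) _).
apply/subset_leq_card/subsetP => f;
  rewrite inE => /andP[/embeddingsP[fI fA] /forallP fg].
have im x : exists i, e i == f x.
  have fxC : f x \in ~: (g @: setT).
    rewrite inE; apply/negP => /imsetP[i _ E].
    by move/forallP/(_ i): (fg x); rewrite E eqxx.
  exists (cast_ord cardC (enum_rank_in fxC (f x))).
  by rewrite /e cast_ordK enum_rankK_in.
have ec x : e (xchoose (im x)) = f x := eqP (xchooseP (im x)).
apply/imsetP; exists [ffun x => xchoose (im x)]; last first.
  by apply/ffunP => x; rewrite !ffunE ec.
apply/embeddingsP; split => [x y|x y xy]; rewrite !ffunE.
  by move/(congr1 e); rewrite !ec => /fI.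
by rewrite adjK !ec; apply: fA.
Qed.

(* Deleting one vertex per residue class from T_r(n) leaves a T_r(n-r): shift by
   [r] every number at or above the deleted vertex of its class. *)
Lemma embeddings_avoiding_turan (g : {ffun 'I_r -> 'I_n}) : 0 < r -> r <= n ->
    g \in embeddings (complete r) (turan r n) ->
  #|embeddings H (turan r (n - r))| <= #|embeddings_avoiding (turan r n) g|.
Proof.
move=> r_gt0 lern /embeddingsP[_ gA].
(* The [r] values of [g] are pairwise adjacent, so their residues are distinct and exhaust all
   classes. Inverting [h] finds the deleted vertex [q i] in the class of [i]. *)
pose h (i : 'I_r) : 'I_r := Ordinal (ltn_pmod (g i) r_gt0).
have hI : injective h.
  move=> x y /(congr1 val) /= E; apply/eqP; apply: contraT => ne.
  by have := gA x y; rewrite adj_graph_of_rel // andbT ne adj_turan E eqxx =>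
    /(_ isT).
have ghK c : g (invF hI c) %% r = c.
  by have := congr1 val (f_invF hI c).
have ginv i : invF hI (h i) = i by rewrite invF_f.
pose q (i : nat) := g (invF hI (Ordinal (ltn_pmod i r_gt0))).
have qmod i : q i %% r = i %% r by rewrite ghK.
pose s (i : nat) := if i < q i then i else i + r.
have s_lt (i : 'I_(n - r)) : s i < n.
  by have := ltn_ord i; rewrite /s; case: ifP => _; lia.
have smod i : s i %% r = i %% r by rewrite /s; case: ifP; rewrite ?modnDr.
have qE i j : i %% r = j %% r -> q i = q j.
  by move=> E; rewrite /q; congr (g (invF hI _)); apply: val_inj.
have sI i j : s i = s j -> i = j.
  move=> E; have := congr1 (modn^~ r) E; rewrite !smod => /qE Eq.
  by move: E; rewrite /s Eq; case: ifP; case: ifP; lia.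
have sg i j : s i != g j.
  apply/eqP => E; have Eh : g j = q i.
    rewrite /q -[in LHS](ginv j); congr (g (invF hI _)); apply: val_inj => /=.
    by rewrite -E smod.
  by move: E; rewrite Eh /s; case: ltnP; lia.
pose shift (f : {ffun U -> 'I_(n - r)}) := [ffun x => Ordinal (s_lt (f x))].
rewrite -(card_imset (f := shift)); last first.
  move=> f1 f2 /ffunP E; apply/ffunP => x; apply: val_inj.
  by have := congr1 val (E x); rewrite !ffunE => /sI.
apply/subset_leq_card/subsetP => _ /imsetP[f /embeddingsP[fI fA] ->].
rewrite inE; apply/andP; split.
  apply/embeddingsP; split => [x y|x y xy]; rewrite !ffunE.
    by move/(congr1 val)/sI/val_inj/fI.
  by have := fA x y xy; rewrite !adj_turan /= !smod.
apply/forallP => x; apply/forallP => i; rewrite ffunE.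
by apply: contraNneq (sg (f x) i) => <-.
Qed.

End Deletion.

(** * Embeddings of the attachment and orderings of its clique *)

Section Attachment.
Variables (V : finType) (r : nat) (H : graph V) (X : {set V}).
Variable H' : graph (V + 'I_r)%type.
Hypothesis X_clique : is_clique H X.
Hypothesis H'_def : clique_attachment H X H'.

Section Host.
Variables (W : finType) (G : graph W).

(** [g] is a plain function so that reorderings [g \o s] fit. *)
Definition compatible (f : {ffun V -> W}) (g : 'I_r -> W) : bool :=
  [forall x, forall i, adj H' (inl x) (inr i) ==> adj G (f x) (g i)].

Definition disjoint_pairs :=
  [set p : {ffun V -> W} * {ffun 'I_r -> W} |
     (p.2 \in embeddings (complete r) G) && (p.1 \in embeddings_avoiding H G
       p.2)].

Lemma sum_disjoint_pairs c :
  \sum_(p in disjoint_pairs) c =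
  \sum_(g in embeddings (complete r) G) #|embeddings_avoiding H G g| * c.
Proof.
transitivity (\sum_(g in embeddings (complete r) G)
    \sum_(f in embeddings_avoiding H G g) c).
  rewrite pair_big_dep /= [RHS](reindex
    (fun p : {ffun V -> W} * {ffun 'I_r -> W} => (p.2, p.1))) /=.
    by apply: eq_bigl => p; rewrite inE.
  by exists (fun p => (p.2, p.1)) => -[].
by apply: eq_bigr => g _; rewrite sum_nat_const.
Qed.

(** Restriction to the two summands of the vertex type is a bijection; injectivity across the
    summands is what avoidance expresses. *)
Lemma card_attachment_embeddings :
  #|embeddings H' G| = #|[set p in disjoint_pairs | compatible p.1 p.2]|.
Proof.
case: H'_def => adjH adjK _.
pose res (f : {ffun V + 'I_r -> W}) : {ffun V -> W} * {ffun 'I_r -> W} :=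
  ([ffun x => f (inl x)], [ffun i => f (inr i)]).
rewrite -(card_imset (f := res)); last first.
  move=> f1 f2 [/ffunP E1 /ffunP E2]; apply/ffunP => -[x|i].
    by have := E1 x; rewrite !ffunE.
  by have := E2 i; rewrite !ffunE.
apply: eq_card => -[f g]; apply/imsetP/idP.
  case=> h /embeddingsP[hI hA] [-> ->].
  rewrite inE [_ \in disjoint_pairs]inE [_ \in embeddings_avoiding _ _ _]inE /=.
  apply/andP; split; [apply/and3P; split|].
  - apply/embeddingsP; split => [i j|i j ij]; rewrite !ffunE;
    first by move/hI => [].
    by apply: hA; rewrite adjK.
  - apply/embeddingsP; split => [x y|x y xy]; rewrite !ffunE;
    first by move/hI => [].
    by apply: hA; rewrite adjH.
  - apply/forallP => x; apply/forallP => i; rewrite !ffunE.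
    by apply/eqP => /hI.
  - apply/forallP => x; apply/forallP => i; rewrite !ffunE.
    by apply/implyP; apply: hA.
rewrite inE [_ \in disjoint_pairs]inE [_ \in embeddings_avoiding _ _ _]inE /=.
case/andP=> /and3P[/embeddingsP[gI gA] /embeddingsP[fI fA] /forallP fg]
  /forallP comp.
have {}fg x i : f x <> g i by apply/eqP; move/forallP/(_ i): (fg x).
have {}comp x i : adj H' (inl x) (inr i) -> adj G (f x) (g i).
  by move=> xi; move/forallP/(_ i)/implyP: (comp x); apply.
exists [ffun z => match z with inl x => f x | inr i => g i end]; last first.
  by congr pair; apply/ffunP => z; rewrite !ffunE.
apply/embeddingsP; split => -[x|i] [y|j]; rewrite !ffunE.
- by move/fI => ->.
- by move/fg.
- by move/esym/fg.
- by move/gI => ->.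
- by rewrite adjH; apply: fA.
- exact: comp.
- by rewrite ![adj _ (inr i) _]adj_sym [adj G _ _]adj_sym; apply: comp.
- by rewrite adjK; apply: gA.
Qed.

(* Averaging over the [r`!] orderings of the attached clique. *)
Lemma fact_card_attachment_embeddings :
  #|embeddings H' G| * r`! =
  \sum_(p in disjoint_pairs) #|[set s : 'S_r | compatible p.1 (p.2 \o s)]|.
Proof.
transitivity (\sum_(s : 'S_r) #|[set p in disjoint_pairs | compatible p.1 (p.2
  \o s)]|).
  have -> : r`! = #|'S_r| by rewrite -card_Sn; apply: eq_card.
  rewrite mulnC -sum_nat_const; apply: eq_bigr => s _.
  rewrite card_attachment_embeddings.
  (* Reordering the clique permutes [disjoint_pairs], so every [s] contributes the same number of
     compatible pairs. *)
  pose act (s : 'S_r) (p : {ffun V -> W} * {ffun 'I_r -> W}) :=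
    (p.1, [ffun i => p.2 (s i)]).
  have actK s1 : cancel (act s1) (act s1^-1%g).
    by case=> f g; congr pair; apply/ffunP => i; rewrite !ffunE permKV.
  have act_pairs s1 p : p \in disjoint_pairs -> act s1 p \in disjoint_pairs.
    case: p => f g.
    rewrite ![_ \in disjoint_pairs]inE ![_ \in embeddings_avoiding _ _ _]inE /=.
    case/and3P=> /embeddingsP[gI gA] -> /forallP fg; apply/and3P; split => //.
      apply/embeddingsP; split => [i j|i j ij]; rewrite !ffunE.
        by move/gI/perm_inj.
      apply: gA; move: ij; rewrite !adj_graph_of_rel // !andbT.
      by rewrite (inj_eq perm_inj).
    apply/forallP => x; apply/forallP => i; rewrite ffunE.
    by move/forallP/(_ (s1 i)): (fg x).
  rewrite -(card_imset _ (can_inj (actK s^-1%g))); apply: eq_card => p.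
  apply/imsetP/idP.
    case=> q; rewrite inE => /andP[qP qC] ->; rewrite inE act_pairs //=.
    apply/forallP => x; apply/forallP => i; rewrite /= ffunE permK.
    by move/forallP/(_ i): (forallP qC x).
  rewrite inE => /andP[pP pC]; exists (act s p); last by rewrite actK.
  rewrite inE act_pairs //=; apply/forallP => x; apply/forallP => i.
  by rewrite ffunE; move/forallP/(_ i): (forallP pC x).
transitivity (\sum_(s : 'S_r)
    \sum_(p in disjoint_pairs | compatible p.1 (p.2 \o s)) 1).
  by apply: eq_bigr => s _; rewrite -sum1_card; apply: eq_bigl => p;
    rewrite inE.
rewrite (exchange_big_dep (mem disjoint_pairs)) /=; last first.
  by move=> s p _ /andP[].
apply: eq_bigr => p pP; rewrite -sum1_card; apply: eq_bigl => s.
by rewrite inE pP.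
Qed.

End Host.

(** No host occurs here: with [a] a matching of non-adjacent pairs, any two hosts can be compared
    through this set. *)
Definition orderings_missing (a : V -> 'I_r) :=
  [set s : 'S_r | [forall x, forall i, adj H' (inl x) (inr i) ==> (s i != a
    x)]].

(** Some permutation [p] sends [a x] to [b x] for all [x] in [X], and composing with [p] is a
    bijection. Values off [X] do not matter because cross edges start in [X]. *)
Lemma orderings_missing_eq (a b : V -> 'I_r) :
    {in X &, injective a} -> {in X &, injective b} ->
  #|orderings_missing a| = #|orderings_missing b|.
Proof.
move=> aI bI; case: H'_def => _ _ crossX.
have [p pE] : exists p : 'S_r, map p (map a (enum X)) = map b (enum X).
  apply: perm_map_eq; rewrite ?size_map // map_inj_in_uniq ?enum_uniq // => x y;
    rewrite !mem_enum; [exact: aI|exact: bI].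
have {}pE x : x \in X -> p (a x) = b x.
  move: pE; rewrite -map_comp => /eq_in_map/(_ x) + xX.
  by rewrite mem_enum => /(_ xX).
rewrite -(card_imset _ (mulIg p)); apply: eq_card => s.
apply/imsetP/idP.
  case=> t; rewrite !inE => /forallP tA ->; apply/forallP => x;
    apply/forallP => i.
  apply/implyP => xi; rewrite permM -pE ?(crossX x i) // (inj_eq perm_inj).
  by move/forallP/(_ i)/implyP: (tA x); apply.
rewrite inE => /forallP sA; exists (s * p^-1)%g; last by rewrite mulgKV.
rewrite inE; apply/forallP => x; apply/forallP => i; apply/implyP => xi.
rewrite permM -(inj_eq (@perm_inj _ p)) permKV pE ?(crossX x i) //.
by move/forallP/(_ i)/implyP: (sA x); apply.
Qed.

(* Hall's condition holds because [f @: J] together with the clique vertices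
   adjacent to all of it is again a clique. *)
Lemma missing_matching (W : finType) (G : graph W) f g :
    0 < r -> ~~ contains (complete r.+1) G ->
    f \in embeddings H G -> g \in embeddings (complete r) G ->
  exists2 a : V -> 'I_r, {in X &, injective a}
    & {in X, forall x, ~~ adj G (f x) (g (a x))}.
Proof.
move=> r_gt0 free /embeddingsP[fI fA] /embeddingsP[gI gA].
have [|a aI aA] := @hall_matching _ _ (Ordinal r_gt0)
    (fun x => [set i | ~~ adj G (f x) (g i)]) X; last first.
  by exists a => // x /aA; rewrite inE.
move=> J JX; set N := \bigcup_(j in J) _.
have adjN x i : x \in J -> i \notin N -> adj G (f x) (g i).
  move=> xJ; apply: contraR => nxi; apply/bigcupP; exists x => //.
  by rewrite inE.
have cl : cliqueb G (f @: J :|: g @: ~: N).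
  apply/cliqueP => _ _ /setUP[] /imsetP[x xI ->] /setUP[] /imsetP[y yI ->] ne.
  - apply: fA; apply: X_clique; rewrite ?(subsetP JX) //.
    by apply: contraNneq ne => ->.
  - by apply: adjN => //; rewrite -in_setC.
  - by rewrite adj_sym; apply: adjN => //; rewrite -in_setC.
  - apply: gA; rewrite adj_graph_of_rel // andbT.
    by apply: contraNneq ne => ->.
have dis : [disjoint f @: J & g @: ~: N].
  apply/pred0Pn => -[_ /andP[/imsetP[x xJ ->] /imsetP[i]]].
  rewrite in_setC => /(adjN x) -/(_ xJ) + E.
  by rewrite E adj_irrefl.
(* The clique has [#|J| + (r - #|N|)] vertices, hence at most [r], and this is Hall's inequality. *)
have := free_clique_card free cl.
rewrite cardsU (disjoint_setI0 dis) cards0 !card_imset // (cardsCs (~: N))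
  setCK card_ord.
by have := max_card (mem N); rewrite card_ord; lia.
Qed.

(** Placing [a x] at a neighbour of [x] would demand the missing edge between [f x] and
    [g (a x)]. *)
Lemma compatible_orderings_leq (W : finType) (G : graph W) (f : {ffun V -> W})
  (g : {ffun 'I_r -> W})
    (a : V -> 'I_r) : {in X, forall x, ~~ adj G (f x) (g (a x))} ->
  #|[set s : 'S_r | compatible G f (g \o s)]| <= #|orderings_missing a|.
Proof.
case: H'_def => _ _ crossX aA.
apply/subset_leq_card/subsetP => s; rewrite !inE => /forallP sA.
apply/forallP => x; apply/forallP => i; apply/implyP => xi.
move/forallP/(_ i)/implyP: (sA x) => /(_ xi) /=.
by apply: contraTneq => ->; apply: aA; apply: crossX xi.
Qed.

(** In the Turan graph a non-adjacent pair shares its class, so [f x] is adjacent to every [g j]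
    with [j != a x]. Avoiding [a] is thus sufficient for compatibility. *)
Lemma orderings_missing_turan n f (g : {ffun 'I_r -> 'I_n}) :
    0 < r -> f \in embeddings H (turan r n) ->
    g \in embeddings (complete r) (turan r n) ->
  exists2 a : V -> 'I_r, {in X &, injective a} &
    #|orderings_missing a| <= #|[set s : 'S_r | compatible (turan r n) f (g \o
      s)]|.
Proof.
move=> r_gt0 fE gE.
have [a aI aA] := missing_matching r_gt0 (turan_free n r_gt0) fE gE.
exists a => //; case: H'_def => _ _ crossX; case/embeddingsP: gE => gI gA.
apply/subset_leq_card/subsetP => s; rewrite !inE => /forallP sA.
apply/forallP => x; apply/forallP => i; apply/implyP => xi /=.
have := aA x (crossX x i xi); rewrite !adj_turan negbK => /eqP ->.
rewrite -adj_turan; apply: gA; rewrite adj_graph_of_rel // andbT eq_sym.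
by move/forallP/(_ i)/implyP: (sA x); apply.
Qed.

End Attachment.

(** * Comparing an arbitrary host with the Turan graph, factor by factor *)

Theorem theorem7 (k : nat) (hk : 3 <= k) (V : finType) (H : graph V)
    (H_free : ~~ contains (complete k) H) (H_good : k_turan_good k H)
    (X : {set V}) (X_clique : is_clique H X)
    (H' : graph (V + 'I_k.-1)%type) (H'_def : clique_attachment H X H') :
  k_turan_good k H'.
Proof.
case: k hk H_free H_good H' H'_def => // r hr H_free [n0 H_good] /= H' H'_def.
have r_gt0 : 0 < r by lia.
(* The shift by [r] keeps [n - r], the order of the host without its clique, in the range of
   [H_good]. *)
exists (n0 + r) => n le_n; rewrite chromatic_number_complete /=.
apply/eqP; rewrite eqn_leq; apply/andP; split; last first.
  apply: (@leq_bigmax_cond _ _ _ (turan r n)); exact: turan_free.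
apply/bigmax_leqP => G free; rewrite leq_num_copies.
(* The factor [r!] on both sides lets the orderings be counted separately for each disjoint pair. *)
rewrite -(leq_pmul2r (fact_gt0 r)) !(fact_card_attachment_embeddings H'_def).
pose N := #|embeddings H (turan r (n - r))|.
(* All terms of this maximum agree by [orderings_missing_eq]; it names their common value, or 0 if
   no map is injective on [X]. *)
pose M := \max_(a : {ffun V -> 'I_r} | [forall x in X, forall y in X, (a x == a
  y) ==> (x == y)])
   #|orderings_missing H' a|.
have injP (a : {ffun V -> 'I_r}) : reflect {in X &, injective a}
    [forall x in X, forall y in X, (a x == a y) ==> (x == y)].
  apply: (iffP forall_inP) => aI x.
    by move=> y /aI/forall_inP ax /ax/implyP axy /eqP/axy/eqP.
  by move=> xX; apply/forall_inP => y yX; apply/implyP => /eqP/aI ->.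
(* This product separates the two counts; the bound from below by the Turan graph comes first. *)
apply: leq_trans (_ : #|embeddings (complete r) (turan r n)| * (N * M) <= _);
  last first.
  apply: leq_trans (_ : \sum_(p in disjoint_pairs r H (turan r n)) M <= _).
    rewrite sum_disjoint_pairs -sum_nat_const; apply: leq_sum => g gE.
    by rewrite leq_mul2r embeddings_avoiding_turan ?orbT //; lia.
  apply: leq_sum => -[f g]; rewrite inE /= => /andP[gE];
    rewrite inE => /andP[fE _].
  apply/bigmax_leqP => a /injP aI.
  (* Any [a] in the maximum may be traded for the matching [b] of this particular pair. *)
  have [b bI] := orderings_missing_turan X_clique H'_def r_gt0 fE gE.
  by apply: leq_trans; rewrite (orderings_missing_eq H'_def aI bI).
apply: leq_trans (_ : \sum_(p in disjoint_pairs r H G) M <= _).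
  apply: leq_sum => -[f g]; rewrite inE /= => /andP[gE];
    rewrite inE => /andP[fE _].
  have [a aI aA] := missing_matching X_clique r_gt0 free fE gE.
  apply: leq_trans (compatible_orderings_leq H'_def aA) _.
  (* The maximum [M] ranges over finite functions, so [a] is repackaged as one. *)
  rewrite (@orderings_missing_eq _ _ _ _ _ H'_def _ [ffun x => a x]) //;
    last first.
    by move=> x y xX yX; rewrite !ffunE; apply: aI.
  apply: leq_bigmax_cond; apply/injP => x y xX yX; rewrite !ffunE; exact: aI.
rewrite sum_disjoint_pairs.
apply: leq_trans (_ : #|embeddings (complete r) G| * (N * M) <= _); last first.
  by rewrite leq_mul2r leq_embeddings_complete_turan ?orbT.
rewrite -sum_nat_const; apply: leq_sum => g /embeddingsP[gI _].
rewrite leq_mul2r; apply/orP; right.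
apply: (embeddings_avoiding_leq free gI); rewrite card_ord => K freeK.
rewrite -leq_num_copies.
have := H_good (n - r); rewrite chromatic_number_complete /= => <-; last by lia.
exact: leq_bigmax_cond.
Qed.
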